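(* Let $K$ be a field, $S=K[x_1,\ldots,x_n]$, let $I\subset S$ be a graded ideal, and let $(\mathbb{F},\partial)$ be the graded minimal free resolution of $S/I$. Let $a\geq 1$ and suppose there exists a homogeneous basis $f_1,\ldots,f_r$ of the free module $\mathbb{F}_a$ such that $$\partial(\mathbb{F}_{a+1})\subset \bigoplus_{i=1}^{r-1} S f_i.$$ Then $\deg f_r\leq t_{a-1}(I)+t_1(I)$.
   Context: $S=K[x_1,\ldots,x_n]$ is the polynomial ring over a field $K$ with the standard grading ($\deg x_i=1$). For the graded minimal free $S$-resolution $\mathbb{F}$ of $S/I$ write $\mathbb{F}_a=\bigoplus_j S(-j)^{b_{aj}}$ and set $t_a(I)=\max\{j : b_{aj}\neq 0\}$, the maximal degree of a homogeneous basis element of $\mathbb{F}_a$. Indexing: $\mathbb{F}$ resolves $S/I$, so $\mathbb{F}_0=S$ (for $I$ proper) and $t_1(I)$ is the maximal degree of a minimal homogeneous generator of $I$. *)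

(* Defs.v *)
(* MathComp + multinomials *)
From HB Require Import structures.
From mathcomp Require Export all_boot all_order all_algebra.
From mathcomp Require Export mpoly.

Set Implicit Arguments.
Unset Strict Implicit.
Unset Printing Implicit Defensive.

Import GRing.Theory.
Local Open Scope ring_scope.

(* The unit ideal is allowed, unlike with the library's [idealr]. *)
Definition graded_ideal (K : fieldType) (n : nat) (I : {mpoly K[n]} -> Prop) :=
  [/\ I 0,
      forall p q, I p -> I q -> I (p + q),
      forall p q, I q -> I (p * q)
    & forall p d, I p -> I (pihomog mdeg d p)].

(* The module \bigoplus_j S(- s j) is represented by 'rV[S]_m with the degree
   shifts s; its component of degree e consists of the rows whose j-th entry
   lies in S_(e - s j), which is 0 when e < s j. *)
Definition homogeneous_elt (K : fieldType) (n m : nat) (s : 'I_m -> nat)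
    (e : nat) (v : 'rV[{mpoly K[n]}]_m) :=
  forall j, if (s j <= e)%N then v 0 j \is (e - s j)%N.-homog else v 0 j == 0.

Definition homogeneous_basis (K : fieldType) (n m : nat) (s : 'I_m -> nat)
    (r : nat) (f : 'I_r -> 'rV[{mpoly K[n]}]_m) (deg : 'I_r -> nat) :=
  (forall i, homogeneous_elt s (deg i) (f i)) /\
  (forall v, exists! c : 'rV[{mpoly K[n]}]_r, v = \sum_i c 0 i *: f i).

(* F_a = \bigoplus_i S(- shift a i), of rank rk a.  The differential
   F_(a.+1) -> F_a is y |-> y *m diff a.  The column aug gives a lift F_0 -> S
   of the augmentation F_0 -> S/I.  A minimal free resolution of S/I has finite
   ranks and only nonnegative shifts, so the types lose no generality. *)
Record free_seq (K : fieldType) (n : nat) := FreeSeq {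
  rk : nat -> nat;
  shift : forall a, 'I_(rk a) -> nat;
  diff : forall a, 'M[{mpoly K[n]}]_(rk a.+1, rk a);
  aug : 'cV[{mpoly K[n]}]_(rk 0)
}.

Definition graded_free_seq (K : fieldType) (n : nat) (F : free_seq K n) :=
  (forall i, aug F i 0 \is (shift (f := F) (a := 0%N) i).-homog) /\
  (forall a (i : 'I_(rk F a.+1)),
     homogeneous_elt (shift (a := a)) (shift i) (row i (diff F a))).

(* Exactness of ... -> F_1 -> F_0 -> S/I -> 0. *)
Definition resolves (K : fieldType) (n : nat) (F : free_seq K n)
    (I : {mpoly K[n]} -> Prop) :=
  [/\ forall p, exists v : 'rV_(rk F 0), I ((v *m aug F) 0 0 - p),
      forall v : 'rV_(rk F 0),
        I ((v *m aug F) 0 0) <-> exists w, v = w *m diff F 0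
    & forall a (v : 'rV_(rk F a.+1)),
        v *m diff F a = 0 <-> exists w, v = w *m diff F a.+1].

(* The image of each F_(a.+1) -> F_a lies in (x_1, ..., x_n) F_a; the ideal
   (x_1, ..., x_n) is the set of polynomials with zero constant term. *)
Definition minimal (K : fieldType) (n : nat) (F : free_seq K n) :=
  forall a (w : 'rV_(rk F a.+1)) j, ((w *m diff F a) 0 j)@_0%MM = 0.

Definition graded_minimal_free_resolution (K : fieldType) (n : nat)
    (F : free_seq K n) (I : {mpoly K[n]} -> Prop) :=
  [/\ graded_free_seq F, resolves F I & minimal F].

(* The value is 0 when F_a = 0. *)
Definition maxshift (K : fieldType) (n : nat) (F : free_seq K n) (a : nat) :=
  (\max_(i < rk F a) shift i)%N.

(* Main.v *)
Require Import Defs.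

Set Implicit Arguments.
Unset Strict Implicit.
Unset Printing Implicit Defensive.

Import GRing.Theory.
Local Open Scope ring_scope.

(** Write [D a] for the differential F_(a+1) -> F_a.  The class of the dual
    basis element f_r^* in Ext^a(S/I, S) is defined because f_r^* vanishes on
    the image of [D a], and I annihilates Ext^a(S/I, S).  So for h in I the
    functional h f_r^* is a boundary: it factors through the differential
    F_a -> F_(a-1), and evaluating at f_r gives h = \sum_i c_i b_i, where the
    c_i are the coordinates of the image of f_r in F_(a-1).

    The polynomial c_i is homogeneous of degree deg f_r - s_i, with s_i the
    degree of the i-th basis element of F_(a-1).  If h is nonzero and
    homogeneous, one of these degrees is at most deg h, since otherwise every
    product c_i b_i would be zero in degree deg h.  Hence
    deg f_r <= s_i + deg h, and it is enough to find a nonzero h in I of degree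
    at most t_1.

    That I annihilates Ext is made explicit by a homotopy
    ([homotopy_of_ideal_elt]): multiplication by h on the resolution lifts the
    zero map of S/I, so it is null-homotopic.  The polynomial h is an entry of
    the composite F_1 -> F_0 -> S, which is nonzero because F_a is
    ([ideal_generator_exists]): minimality forces F_0 to have rank one, so a
    zero composite would make [D 0] vanish, and then all F_a with a > 0. *)

(** * Constant terms and minimality *)

(** A kernel element is a boundary, so minimality puts its coordinates in the
    maximal ideal. *)
Lemma cycle_constant_term (K : fieldType) (n : nat) (F : free_seq K n) I a
    (v : 'rV_(rk F a.+1)) j :
  resolves F I -> minimal F -> v *m diff F a = 0 -> (v 0 j)@_0%MM = 0.
Proof. by move=> [_ _ exF] minF /exF[w ->]; apply: minF. Qed.

Lemma aug_cycle_constant_term (K : fieldType) (n : nat) (F : free_seq K n) I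
    (v : 'rV_(rk F 0)) j :
  resolves F I -> minimal F -> I ((v *m aug F) 0 0) -> (v 0 j)@_0%MM = 0.
Proof. by move=> [_ exF _] minF /exF[w ->]; apply: minF. Qed.

Lemma rank_succ_eq0 (K : fieldType) (n : nat) (F : free_seq K n) I a :
  resolves F I -> minimal F -> diff F a = 0 -> rk F a.+1 = 0%N.
Proof.
move=> resF minF D0; apply/eqP; rewrite -leqn0 leqNgt; apply/negP=> lt0.
pose j := Ordinal lt0.
have := @cycle_constant_term _ _ _ _ _ (delta_mx 0 j) j resF minF.
rewrite D0 mulmx0 mxE !eqxx mcoeff1 eqxx => /(_ erefl)/eqP.
by rewrite oner_eq0.
Qed.

Lemma rank_eq0_le (K : fieldType) (n : nat) (F : free_seq K n) I a b :
  resolves F I -> minimal F -> (a <= b)%N -> rk F a = 0%N -> rk F b = 0%N.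
Proof.
move=> resF minF; elim: b => [|b IHb]; first by rewrite leqn0 => /eqP->.
rewrite leq_eqVlt => /predU1P[->//|/IHb{}IHb /IHb rk0].
apply: (rank_succ_eq0 resF minF); apply/matrixP=> i [j ltj].
by exfalso; move: ltj; rewrite rk0.
Qed.

(** * A nonzero element of the ideal in a degree at most t_1 *)

Lemma pihomog_mdeg0 (R : nzRingType) (n : nat) (p : {mpoly R[n]}) :
  pihomog mdeg 0 p = (p@_0%MM)%:MP.
Proof.
rewrite pihomogE (eq_bigl (pred1 0%MM)) => [|m]; last exact: mdeg_eq0.
have [p0|/memN_msupp_eq0 p0] := boolP (0%MM \in msupp p).
  rewrite big_mkcond (bigD1_seq 0%MM) ?msupp_uniq //=.
  by rewrite big1 ?eqxx ?addr0 ?mpolyX0 ?alg_mpolyC // => m /negPf->.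
by rewrite p0 mpolyC0 big1 // => m /eqP->; rewrite p0 scale0r.
Qed.

(** If every augmentation value lay in the maximal ideal, then surjectivity
    onto S/I would put an element with nonzero constant term in I; gradedness
    then gives 1 in I, so all of F_0 is a boundary and minimality fails. *)
Lemma aug_nonmaximal_entry (K : fieldType) (n : nat) (I : {mpoly K[n]} -> Prop)
    (F : free_seq K n) :
  graded_ideal I -> resolves F I -> minimal F -> (0 < rk F 0)%N ->
  exists i, (aug F i 0)@_0%MM != 0.
Proof.
move=> [_ _ IM Ih] resF minF lt0; apply/existsP; apply: contraT.
move=> /existsPn aug0.
have [sur _ _] := resF; have [v] := sur 1.
set q := _ - 1 => Iq.
have q0 : q@_0%MM = -1.
  rewrite /q mcoeffB mcoeff1 eqxx mxE raddf_sum big1 ?sub0r // => i _.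
  by rewrite [LHS]rmorphM /= (eqP (negPn (aug0 i))) mulr0.
have I1 : I 1.
  have -> : 1 = (-1) * pihomog mdeg 0 q.
    by rewrite pihomog_mdeg0 q0 mpolyCN mulrNN mulr1.
  by apply/IM/Ih.
have j : 'I_(rk F 0) by exact: Ordinal lt0.
have := @aug_cycle_constant_term _ _ _ _ (delta_mx 0 j) j resF minF.
rewrite -[X in I X]mulr1 => /(_ (IM _ _ I1))/eqP.
by rewrite mxE !eqxx mcoeff1 eqxx oner_eq0.
Qed.

(** Were j different from i, the Koszul relation [aug_i e_j - aug_j e_i] would
    be a cycle whose coordinate [aug_i] is outside the maximal ideal. *)
Lemma aug_nonmaximal_entry_unique (K : fieldType) (n : nat) (I : {mpoly K[n]} -> Prop)
    (F : free_seq K n) i j :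
  graded_ideal I -> resolves F I -> minimal F ->
  (aug F i 0)@_0%MM != 0 -> j = i.
Proof.
move=> [I0 _ _ _] resF minF u; apply: contraTeq u => ij.
pose v : 'rV_(rk F 0) := aug F i 0 *: delta_mx 0 j - aug F j 0 *: delta_mx 0 i.
have := @aug_cycle_constant_term _ _ _ _ v j resF minF.
rewrite mulmxBl -!scalemxAl -!rowE !mxE mulrC subrr => /(_ I0).
by rewrite !eqxx (negPf ij) mulr1 mulr0 subr0 negbK => ->.
Qed.

(** The witness is the image in S of a basis element of F_1.  Since F_0 has a
    single basis element, with nonzero image in S, these images vanish together
    only if [D 0 = 0]. *)
Lemma ideal_generator_exists (K : fieldType) (n : nat)
    (I : {mpoly K[n]} -> Prop) (F : free_seq K n) a :
  graded_ideal I -> graded_minimal_free_resolution F I ->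
  (0 < a)%N -> (0 < rk F a)%N ->
  exists d h, [/\ (d <= maxshift F 1)%N, h \is d.-homog, h != 0 & I h].
Proof.
move=> gI [[gaug gdiff] resF minF] a0 rka.
have [i ui] : exists i, (aug F i 0)@_0%MM != 0.
  apply: (aug_nonmaximal_entry gI resF minF); rewrite lt0n; apply: contraTneq rka.
  by move/(rank_eq0_le resF minF (leq0n a))->.
have eqi j : j = i by apply: aug_nonmaximal_entry_unique gI resF minF ui.
have [k nzk] : exists k, (diff F 0 *m aug F) k 0 != 0.
  apply/existsP; apply: contraLR rka => /existsPn DA0; rewrite -leqNgt leqn0.
  apply/eqP/(rank_eq0_le resF minF a0)/(rank_succ_eq0 resF minF).
  apply/matrixP=> k j; rewrite mxE; apply/eqP; move/negPn: (DA0 k).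
  rewrite mxE (bigD1 i) //= big1 => [|l]; last by rewrite (eqi l) eqxx.
  rewrite addr0 mulf_eq0 (eqi j) => /orP[//|/eqP aug0].
  by rewrite aug0 mcoeff0 eqxx in ui.
exists (shift k), ((diff F 0 *m aug F) k 0); split=> //.
- exact: (leq_bigmax k).
- rewrite mxE rpred_sum // => j _; have := gdiff 0%N k j; rewrite mxE.
  case: ifP => [le_jk hD|_ /eqP->]; last by rewrite mul0r dhomog0.
  by rewrite -(subnK le_jk) dhomogM.
have [_ exF _] := resF; have := (exF (row k (diff F 0))).2.
rewrite -row_mul mxE; apply; exists (delta_mx 0 k); exact: rowE.
Qed.

(** * The ideal acts null-homotopically *)

Lemma factor_rows (R : comNzRingType) (m p q : nat) (A : 'M[R]_(m, q))
    (B : 'M_(p, q)) :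
  (forall i, exists w, row i A = w *m B) -> exists W, A = W *m B.
Proof.
move=> rowA; have rowAb i : exists w, row i A == w *m B.
  by have [w ->] := rowA i; exists w.
exists (\matrix_i xchoose (rowAb i)); apply/row_matrixP=> i.
by rewrite row_mul rowK; apply/eqP; apply: (xchooseP (rowAb i)).
Qed.

(** The maps [s] and [s'] are the components in degrees a and a + 1 of a
    null-homotopy of multiplication by [h].  The induction needs only the
    consequence [D s D = h D] of the homotopy equation one step below: it says
    that [h - D s] takes values in cycles, which exactness lifts to [s']. *)
Lemma homotopy_of_ideal_elt (K : fieldType) (n : nat)
    (I : {mpoly K[n]} -> Prop) (F : free_seq K n) h a :
  graded_ideal I -> resolves F I -> I h ->
  exists (s : 'M_(rk F a, rk F a.+1)) (s' : 'M_(rk F a.+1, rk F a.+2)),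
    h%:M = diff F a *m s + s' *m diff F a.+1.
Proof.
move=> [_ _ IM _] [_ ex0 exF] Ih.
have lift b (A : 'M_(rk F b.+1)) :
    A *m diff F b = 0 -> exists B, A = B *m diff F b.+1.
  move=> AD0; apply: factor_rows => i; apply/exF.
  by rewrite -row_mul AD0 row0.
have step b (s : 'M_(rk F b, rk F b.+1)) :
    diff F b *m s *m diff F b = h *: diff F b ->
    exists s' : 'M_(rk F b.+1, rk F b.+2),
      h%:M = diff F b *m s + s' *m diff F b.+1.
  move=> DsD; have [|s' Es'] := lift b (h%:M - diff F b *m s).
    by rewrite mulmxBl DsD mul_scalar_mx subrr.
  by exists s'; rewrite -Es' addrC subrK.
suff [s Ds]: exists s : 'M_(rk F a, rk F a.+1),
    diff F a *m s *m diff F a = h *: diff F a.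
  by have [s' Es'] := step a s Ds; exists s, s'.
elim: a => [|a [s Ds]].
  have [i|s Es] := @factor_rows _ _ _ _ h%:M (diff F 0).
    apply/ex0; rewrite -row_mul mul_scalar_mx !mxE mulrC; exact: IM.
  by exists s; rewrite -mulmxA -Es mul_mx_scalar.
have [s' Es'] := step a s Ds; exists s'; rewrite -mulmxA.
have -> : s' *m diff F a.+1 = h%:M - diff F a *m s by rewrite Es' addrC addKr.
have DD : diff F a.+1 *m diff F a = 0.
  apply/row_matrixP=> i; rewrite row_mul row0; apply/exF.
  by exists (delta_mx 0 i); rewrite -rowE.
by rewrite mulmxBr mulmxA DD mul0mx subr0 mul_mx_scalar.
Qed.

(** * Coordinates and degrees *)

(** [C] is the inverse of the matrix [B] with rows [f i]: existence of
    coordinates gives [C B = 1], and their uniqueness turns [B C B = B] into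
    [B C = 1], which holds row by row as stated. *)
Lemma basis_coord_mx (K : fieldType) (n m r : nat) (s : 'I_m -> nat)
    (f : 'I_r -> 'rV[{mpoly K[n]}]_m) deg :
  homogeneous_basis s f deg ->
  exists C : 'M_(m, r), forall i, f i *m C = delta_mx 0 i.
Proof.
move=> [_ basf].
pose B := \matrix_i f i.
have mulB (c : 'rV_r) : c *m B = \sum_i c 0 i *: f i.
  by rewrite mulmx_sum_row; apply: eq_bigr => i _; rewrite rowK.
have [i|C CB] := @factor_rows _ _ _ _ 1%:M B.
  by have [c [-> _]] := basf (row i 1%:M); exists c; rewrite mulB.
exists C => i.
have [c [_ uniq_c]] := basf (f i); rewrite -(uniq_c (f i *m C)).
  by apply: uniq_c; rewrite -mulB -rowE rowK.
by rewrite -mulB -mulmxA -CB mulmx1.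
Qed.

Lemma mcoeff_mul_homog_lt (K : fieldType) (n d : nat) (p q : {mpoly K[n]}) m :
  p \is d.-homog -> (mdeg m < d)%N -> (p * q)@_m = 0.
Proof.
move=> hp lt_md; rewrite mcoeffM big1 // => k /eqP Em.
rewrite (dhomog_nemf_coeff hp) ?mul0r // neq_ltn.
by rewrite (leq_ltn_trans _ lt_md) // [leqRHS](congr1 mdeg Em) mdegD leq_addr.
Qed.

(** The entries of [b] are arbitrary, but multiplying by them cannot create
    terms of degree below [e - s i] from the [i]-th coordinate of [v]. *)
Lemma degree_le_of_comb (K : fieldType) (n m : nat) (s : 'I_m -> nat) e
    (v : 'rV[{mpoly K[n]}]_m) (b : 'cV_m) d :
  homogeneous_elt s e v -> (v *m b) 0 0 \is d.-homog -> (v *m b) 0 0 != 0 ->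
  (e <= \max_i s i + d)%N.
Proof.
move=> hv hd nz; rewrite leqNgt; apply/negP=> lt_e; case/negP: nz.
set h := (v *m b) 0 0 in hd *; apply/eqP/mpolyP=> mm; rewrite mcoeff0.
have [dm|/(dhomog_nemf_coeff hd)//] := eqVneq (mdeg mm) d.
rewrite /h mxE raddf_sum big1 // => i _ /=.
have := hv i; case: ifP => [_ hvi|_ /eqP->]; last by rewrite mul0r mcoeff0.
apply: mcoeff_mul_homog_lt hvi _; rewrite dm ltn_subRL.
by apply: leq_ltn_trans lt_e; rewrite leq_add2r (leq_bigmax i).
Qed.

Lemma homogeneous_elt_diff (K : fieldType) (n : nat) (F : free_seq K n) a e
    (v : 'rV_(rk F a.+1)) :
  graded_free_seq F -> homogeneous_elt (@shift K n F a.+1) e v ->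
  homogeneous_elt (@shift K n F a) e (v *m diff F a).
Proof.
move=> [_ gdiff] hv j; rewrite mxE.
have term k : if (shift j <= e)%N then
    v 0 k * diff F a k j \is (e - shift j)%N.-homog
  else v 0 k * diff F a k j == 0.
  have := hv k; have := gdiff a k j; rewrite mxE.
  case: (leqP (shift k) e) => [le_ke|_ _ /eqP->]; last first.
    by rewrite mul0r dhomog0 eqxx; case: ifP.
  case: (leqP (shift j) (shift k)) => [le_jk hD hvk|_ /eqP-> _]; last first.
    by rewrite mulr0 dhomog0 eqxx; case: ifP.
  rewrite (leq_trans le_jk le_ke).
  have -> : (e - shift j = (e - shift k) + (shift k - shift j))%N.
    by rewrite addnBA // subnK.
  exact: dhomogM.
case: ifP term => _ term; first by rewrite rpred_sum.
by rewrite big1 // => k _; apply/eqP.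
Qed.

Theorem proposition2 (K : fieldType) (n : nat) (I : {mpoly K[n]} -> Prop)
  (F : free_seq K n) (a r : nat)
  (f : 'I_r.+1 -> 'rV[{mpoly K[n]}]_(rk F a)) (deg : 'I_r.+1 -> nat) :
  graded_ideal I ->
  graded_minimal_free_resolution F I ->
  (1 <= a)%N ->
  homogeneous_basis (@shift K n F a) f deg ->
  (forall y : 'rV[{mpoly K[n]}]_(rk F a.+1),
     exists c : 'I_r.+1 -> {mpoly K[n]},
       y *m diff F a = \sum_(i < r.+1 | i != ord_max) c i *: f i) ->
  (deg ord_max <= maxshift F a.-1 + maxshift F 1)%N.
Proof.
move=> gI resF; have [gF exF minF] := resF.
case: a f => // a f _ basf omit /=.
have [C fC] := basis_coord_mx basf; have [hf _] := basf.
have rka : (0 < rk F a.+1)%N.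
  rewrite lt0n; apply/negP=> /eqP rk0.
  have /matrixP/(_ 0 ord_max)/eqP := fC ord_max.
  rewrite !mxE !eqxx big1 => [|[k ltk] _]; last by exfalso; rewrite rk0 in ltk.
  by rewrite eq_sym oner_eq0.
have [d [h [le_d hd nzh Ih]]] := ideal_generator_exists gI resF (ltn0Sn a) rka.
have [s [s' Eh]] := homotopy_of_ideal_elt a gI exF Ih.
(* The column [C * e_r] is the functional f_r^*. *)
have im0 (y : 'rV_(rk F a.+2)) :
    (y *m diff F a.+1 *m C *m (delta_mx ord_max 0 : 'cV_r.+1)) 0 0 = 0.
  have [c ->] := omit y; rewrite -colE mxE mulmx_suml summxE big1 // => i ni.
  by rewrite -scalemxAl fC !mxE eq_sym (negPf ni) mulr0.
pose b := s *m C *m (delta_mx ord_max 0 : 'cV_r.+1).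
have Ehb : (f ord_max *m diff F a *m b) 0 0 = h.
  have : (f ord_max *m h%:M *m C *m (delta_mx ord_max 0 : 'cV_r.+1)) 0 0 = h.
    by rewrite mul_mx_scalar -!scalemxAl fC -colE !mxE !eqxx mulr1.
  rewrite Eh mulmxDr !mulmxDl mxE mulmxA (mulmxA _ s') im0 addr0 => <-.
  by rewrite /b !mulmxA.
apply: leq_trans (leq_add (leqnn _) le_d).
by apply: (degree_le_of_comb (b := b) (homogeneous_elt_diff gF (hf ord_max)));
  rewrite Ehb.
Qed.
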